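(* Let $n\ge4$, let $T$ be a triangulation of the $n$-gon with set of diagonals $\overline T$, and let $\Sigma_T$ be the associahedral fan in $\mathbb{R}^{n-3}$ obtained as the image of $\mathrm{Pf}_1^+(n)$ under $\phi\circ\pi$, i.e. the complete fan whose maximal cones are generated by $\{\overline W_{a,b}:\{a,b\}\in\overline{T'}\}$ for the triangulations $T'$ of the $n$-gon. In the basis of $\mathbb{R}^{n-3}$ consisting of the rays $\overline W_\delta$ corresponding to the diagonals $\delta\in\overline T$, the fan $\Sigma_T$ equals the $\mathbf{g}$-vector fan of $T$.
   Context: Indices in $[n]$ are modulo $n$. Edges $\{i,j\},\{i',j'\}$ with $i<j$, $i'<j'$ cross if $i<i'<j<j'$ or $i'<i<j'<j$. A triangulation $T$ of the $n$-gon is a maximal set of pairwise non-crossing elements of $\binom{[n]}{2}$ (it has $2n-3$ elements, including all boundary edges $\{i,i+1\}$); $\overline T$ is the set of its $n-3$ diagonals (non-boundary edges). $\mathrm{Pf}_1^+(n)$ is the set of $v\in\mathbb{R}^{\binom{[n]}{2}}$ such that for all $a<a'<b<b'$ the maximum of $v_{a,b}+v_{a',b'}$, $v_{a,a'}+v_{b,b'}$, $v_{a,b'}+v_{a',b}$ is attained at least twice and is attained by $v_{a,b}+v_{a',b'}$. For $\{i,j\}\in\binom{[n]}{2}$, $W_{i,j}\in\mathbb{R}^{\binom{[n]}{2}}$ has $\{a,b\}$-coordinate $1$ if exactly one of $a,b$ lies in the cyclic interval $\{i,i+1,\dots,j-1\}$, and $0$ otherwise. The maximal cones of $\mathrm{Pf}_1^+(n)$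 are $L_n+\mathrm{cone}\{W_{a,b}:\{a,b\}\in\overline{T'}\}$ over triangulations $T'$, with $L_n=\mathrm{span}\{W_{i,i+1}:i\in[n]\}$. $\pi:\mathbb{R}^{\binom{[n]}{2}}\to\mathbb{R}^T$ keeps the coordinates in $T$; $\phi:\mathbb{R}^T\to\mathbb{R}^{\overline T}\cong\mathbb{R}^{n-3}$ is a surjective linear map with kernel $\pi(L_n)$ (of dimension $n$); $\overline W_{a,b}:=\phi(\pi(W_{a,b}))$. $\mathbf{g}$-vectors: $T$ is drawn with the vertices of the $n$-gon, while a pair $\{a,b\}\in\binom{[n]}{2}$ is regarded as a pair of sides, the $a$-th side being $\{a-1,a\}$. For $\delta=\{i,j\}\in\overline T$ let $q(\delta)$ be the quadrilateral formed by the two triangles of $T$ adjacent to $\delta$, with vertices $i,p,j,q$ in this cyclic order. The crossing sign $\varepsilon(\delta\in T,\{a,b\})$ is $+1$ if one of $a,b$ lies in the cyclic interval $\{q+1,\dots,i\}$ and the other in $\{p+1,\dots,j\}$; it is $-1$ if one of $a,b$ lies in $\{i+1,\dots,p\}$ and the other in $\{j+1,\dots,q\}$; and it is $0$ otherwise. (So it is nonzero exactly when the segment joining sides $a$ and $b$ crosses two opposite sides of $q(\delta)$, the sign being $+1$ for a Z and $-1$ for a reversed Z, with vertices labelled clockwise.) The $\mathbf{g}$-vector is $\mathbf{g}(T,\{a,b\})=(\varepsilon(\delta\in T,\{a,b\}))_{\delta\in\overline T}\in\mathbb{R}^{\overline T}$. The $\mathbf{g}$-vector fan of $T$ is the fan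 whose maximal cones are generated by $\{\mathbf{g}(T,\{a,b\}):\{a,b\}\in\overline{T'}\}$, for all triangulations $T'$ of the $n$-gon. *)

(* Defs.v *)
From HB Require Import structures.
From mathcomp Require Import all_boot all_order all_algebra.
From mathcomp Require Import boolp classical_sets reals.

Set Implicit Arguments.
Unset Strict Implicit.
Unset Printing Implicit Defensive.

Import Order.TTheory GRing.Theory Num.Theory.

Local Open Scope ring_scope.

(* Pairs {i, j} of elements of [n], encoded as ordered pairs (i, j), i < j;
   [n] is 'I_n = {0, ..., n - 1}, with cyclic successor ordS and predecessor
   ord_pred. *)
Definition edge (n : nat) := {e : 'I_n * 'I_n | (e.1 < e.2)%N}.

Section Combinatorics.
Variable n : nat.
Implicit Types (i j a b c p q : 'I_n) (d e f : edge n) (T : {set edge n}).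

Definition fst_end e : 'I_n := (val e).1.
Definition snd_end e : 'I_n := (val e).2.

(* The closed cyclic interval {i, i+1, ..., j}: c belongs to it when, going
   upwards from i, one needs no more steps to reach c than to reach j. *)
Definition cyc_itv i j : {set 'I_n} :=
  [set c : 'I_n | ((c + (n - i)) %% n <= (j + (n - i)) %% n)%N].

Definition crossing e f : bool :=
  (fst_end e < fst_end f < snd_end e)%N && (snd_end e < snd_end f)%N ||
  (fst_end f < fst_end e < snd_end f)%N && (snd_end f < snd_end e)%N.

Definition noncrossing T : bool :=
  [forall e in T, forall f in T, ~~ crossing e f].

Definition triangulation T : bool := maxset noncrossing T.

Definition boundary e : bool :=
  (snd_end e == ordS (fst_end e)) || (fst_end e == ordS (snd_end e)).

Definition diagonals T : {set edge n} := [set e in T | ~~ boundary e].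

Definition joined T a b : bool :=
  [exists e in T, (val e == (a, b)) || (val e == (b, a))].

(* The quadrilateral q(d), d = {i, j} with i < j, has vertices i, p, j, q. *)
Definition quad T d p q : bool :=
  let i := fst_end d in let j := snd_end d in
  [&& (i < p < j)%N, joined T i p, joined T p j,
      (q < i)%N || (j < q)%N, joined T j q & joined T q i].

Definition separated e (A B : {set 'I_n}) : bool :=
  (fst_end e \in A) && (snd_end e \in B) ||
  (snd_end e \in A) && (fst_end e \in B).

(* When T is a triangulation and d one of its diagonals, exactly one pair
   (p, q) satisfies quad T d p q. *)
Definition crossing_sign T d e : int :=
  let i := fst_end d in let j := snd_end d in
  if [exists p, exists q, quad T d p q &&
        separated e (cyc_itv (ordS q) i) (cyc_itv (ordS p) j)] then 1
  else if [exists p, exists q, quad T d p q &&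
        separated e (cyc_itv (ordS i) p) (cyc_itv (ordS j) q)] then -1
  else 0.

End Combinatorics.

Section Cones.
Local Open Scope classical_set_scope.
Variables (R : realType) (V : lmodType R).

Definition cone (I : finType) (A : {set I}) (g : I -> V) : set V :=
  [set x | exists c : I -> R,
     (forall i, 0 <= c i) /\ x = \sum_(i in A) c i *: g i].

Definition face (F C : set V) : Prop :=
  exists l : {scalar V},
    (forall x, C x -> 0 <= l x) /\ F = C `&` [set x | l x = 0].

Definition fan_of (M : set (set V)) : set (set V) :=
  [set F | exists2 C, M C & face F C].

End Cones.

Section Fans.
Variables (R : realType) (n : nat).
Implicit Types (T : {set edge n}).

Definition edge_space : vectType R := {ffun edge n -> R^o}.

Definition coord_space T : vectType R := {ffun {e : edge n | e \in T} -> R^o}.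

(* v_{a,b} for a < b (and 0 otherwise) *)
Definition entry (v : edge_space) (a b : 'I_n) : R := oapp v 0 (insub (a, b)).

Definition Pf1plus : set edge_space :=
  fun v => forall a a' b b' : 'I_n, (a < a' < b)%N -> (b < b')%N ->
    let x := entry v a b + entry v a' b' in
    let y := entry v a a' + entry v b b' in
    let z := entry v a b' + entry v a' b in
    let m := Num.max x (Num.max y z) in
    (2 <= count (pred1 m) [:: x; y; z])%N /\ x = m.

Definition Wvec (i j : 'I_n) : edge_space :=
  [ffun e : edge n => ((fst_end e \in cyc_itv i (ord_pred j)) (+)
                       (snd_end e \in cyc_itv i (ord_pred j)))%:R].

Definition W (e : edge n) : edge_space := Wvec (fst_end e) (snd_end e).

Definition lineality : {vspace edge_space} :=
  <<[seq Wvec i (ordS i) | i : 'I_n]>>%VS.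

Definition Pf1plus_cone T : set edge_space :=
  [set u + w | u in [set u | u \in lineality] & w in cone (diagonals T) W]%classic.

Definition restrict T (v : edge_space) : coord_space T :=
  [ffun e : {e : edge n | e \in T} => v (val e)].

Fact restrict_is_linear T : linear (@restrict T).
Proof. by move=> k u v; apply/ffunP=> e; rewrite !ffunE. Qed.

HB.instance Definition _ T :=
  GRing.isLinear.Build R edge_space (coord_space T) _ (@restrict T)
    (@restrict_is_linear T).

Definition proj T : 'Hom(edge_space, coord_space T) := linfun (@restrict T).

Section Associahedral.
Local Open Scope classical_set_scope.
Variables (T : {set edge n})
  (phi : 'Hom(coord_space T, coord_space (diagonals T))).

Definition Wbar (e : edge n) : coord_space (diagonals T) := phi (proj T (W e)).

Definition Sigma : set (set (coord_space (diagonals T))) :=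
  fan_of [set C | exists2 T' : {set edge n},
                    triangulation T' & C = cone (diagonals T') Wbar].

(* The cones of Sigma are the images of the cones of Pf1plus. *)
Lemma Sigma_image : lker phi = (proj T @: lineality)%VS ->
  Sigma = fan_of [set C | exists2 T' : {set edge n},
                    triangulation T' & C = (phi \o proj T) @` Pf1plus_cone T'].
Proof.
move=> kerphi.
have WbarE c T' : \sum_(i in diagonals T') c i *: Wbar i =
    phi (proj T (\sum_(i in diagonals T') c i *: W i)).
  by rewrite !linear_sum; apply: eq_bigr => e _; rewrite !linearZ.
have imE T' : (phi \o proj T) @` Pf1plus_cone T' = cone (diagonals T') Wbar.
  apply/seteqP; split=> x /=.
    move=> [_ [u Lu [w [c [c_ge0 ->]] <-]] <-]; exists c; split=> //.
    have /eqP phiu0 : phi (proj T u) == 0.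
      by rewrite -memv_ker kerphi memv_img.
    by rewrite WbarE !linearD /= phiu0 add0r.
  move=> [c [c_ge0 ->]]; exists (\sum_(i in diagonals T') c i *: W i).
    exists 0; first exact: mem0v.
    exists (\sum_(i in diagonals T') c i *: W i); last by rewrite add0r.
    by exists c.
  by rewrite /= WbarE.
congr fan_of; apply/seteqP; split=> C [T' triT' ->]; exists T' => //.
Qed.

Definition Wbar_basis :
    #|{: {e : edge n | e \in diagonals T}}|.-tuple (coord_space (diagonals T)) :=
  [tuple Wbar (val (enum_val k)) | k < #|{: {e : edge n | e \in diagonals T}}|].

Definition Wbar_coords (x : coord_space (diagonals T)) :
    coord_space (diagonals T) :=
  [ffun d : {e : edge n | e \in diagonals T} =>
     coord Wbar_basis (enum_rank d) x].

End Associahedral.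

Definition gvector T (e : edge n) : coord_space (diagonals T) :=
  [ffun d : {e : edge n | e \in diagonals T} => (crossing_sign T (val d) e)%:~R].

Definition gvector_fan T : set (set (coord_space (diagonals T))) :=
  fan_of [set C | exists2 T' : {set edge n},
                    triangulation T' & C = cone (diagonals T') (@gvector T)]%classic.

End Fans.

Arguments Pf1plus R n : clear implicits.
Arguments gvector_fan R {n} T.

(* Main.v *)
From HB Require Import structures.
Require Import Defs.
From mathcomp Require Import all_boot all_order all_algebra.
From mathcomp Require Import boolp classical_sets reals.
From mathcomp Require Import zify ring lra.

(* Regard a vector v as a function of two vertices; W_e is then the split
   pseudometric of the two arcs cut out by e.

   A diagonal d = {i, j} of T with quadrilateral i, p, j, q has a shear
   coordinate v_ip + v_jq - v_pj - v_qi.  It only reads coordinates in T,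
   vanishes on L_n, and takes the value -2 g(T, e)_d at W_e; at the W_e with e
   in T it is -2 if e = d and 0 otherwise.  So the shear map is onto and factors
   through R^T / pi(L_n); comparing dimensions with phi, both maps have the same
   kernel, and W_e is congruent to the sum of the g(T, e)_d W_d.  This yields the
   basis property and identifies the coordinates of Wbar_e with g(T, e).

   For the support, W is a basis of the whole space, with dual basis
   c_ij(v) = (v_{i-1,j-1} + v_{i,j} - v_{i-1,j} - v_{i,j-1}) / 2.  The four-point
   condition says that c_ij >= 0 for diagonals and that diagonals with nonzero
   coefficients do not cross, so every v in Pf_1^+ lies in the cone of some
   triangulation; conversely, the splits of a triangulation never separate the same
   four vertices a < a' < b < b' both as aa' | bb' and as ab' | a'b. *)

Set Implicit Arguments.
Unset Strict Implicit.
Unset Printing Implicit Defensive.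

Import Order.TTheory GRing.Theory Num.Theory.
Local Open Scope ring_scope.

(** * Cyclic intervals, splits and quartets *)

Section Combinatorics.
Variable n : nat.
Implicit Types (i j a b c p q x y : 'I_n) (d e f : edge n) (T : {set edge n}).

Lemma ends_lt e : (fst_end e < snd_end e)%N.
Proof. exact: (valP e). Qed.

Lemma ord_eqE i j : (i == j) = (i == j :> nat).
Proof. by []. Qed.

Lemma edge_eq e f : fst_end e = fst_end f -> snd_end e = snd_end f -> e = f.
Proof.
by case: e f => [[? ?] ?] [[? ?] ?] h1 h2; apply: val_inj; congr pair.
Qed.

Lemma modn_shift i c : ((c + (n - i)) %% n = if i <= c then c - i else c + (n - i))%N.
Proof.
have hi := ltn_ord i; have hc := ltn_ord c; case: leqP => h.
  have -> : (c + (n - i) = (c - i) + n)%N by lia.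
  by rewrite modnDr modn_small //; lia.
by rewrite modn_small //; lia.
Qed.

Lemma mem_cyc_itv i j c : (c \in cyc_itv i j) =
  if (i <= j)%N then (i <= c <= j)%N else (i <= c)%N || (c <= j)%N.
Proof.
rewrite inE !modn_shift.
have := ltn_ord i; have := ltn_ord j; have := ltn_ord c.
by case: (leqP i c); case: (leqP i j); lia.
Qed.

Lemma val_ordS i : ordS i = (if i.+1 == n then 0 else i.+1)%N :> nat.
Proof.
case: eqP => h; rewrite /= ?h ?modnn // modn_small //.
by have := ltn_ord i; lia.
Qed.

Lemma val_ord_pred i : ord_pred i = (if i == 0 :> nat then n.-1 else i.-1)%N :> nat.
Proof.
have hi := ltn_ord i; case: eqP => h /=; first by rewrite h add0n modn_small; lia.
have -> : ((i + n).-1 = i.-1 + n)%N by lia.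
by rewrite modnDr modn_small //; lia.
Qed.

Lemma mem_arc x y c : x != y -> (c \in cyc_itv (ordS x) y) =
  if (x < y)%N then (x < c <= y)%N else (x < c)%N || (c <= y)%N.
Proof.
rewrite ord_eqE /= => nxy; rewrite mem_cyc_itv val_ordS.
have := ltn_ord x; have := ltn_ord y; have := ltn_ord c.
by case: eqP => h; rewrite ?leq0n; case: (ltnP x y); lia.
Qed.

(** The arc supporting the split of [W e]. As the ends of [e] are sorted, it never wraps around
    0. *)
Definition side e c : bool := (fst_end e <= c < snd_end e)%N.

Lemma mem_cyc_itv_ends e c :
  (c \in cyc_itv (fst_end e) (ord_pred (snd_end e))) = side e c.
Proof.
have h := ends_lt e; rewrite mem_cyc_itv val_ord_pred /side.
have hj := ltn_ord (snd_end e); have hc := ltn_ord c.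
case: eqP => [|h']; first by lia.
by rewrite ifT; lia.
Qed.

(** Walking upwards from [x] to [y] passes the sides numbered [x+1, ..., y], and [side e] flips
    exactly on passing a side numbered by an end of [e]. This parity links splits of vertices to
    pairs of sides in the crossing sign. *)
Lemma side_arc e x y : x != y ->
  side e x (+) side e y =
  (fst_end e \in cyc_itv (ordS x) y) (+) (snd_end e \in cyc_itv (ordS x) y).
Proof.
move=> nxy; rewrite !mem_arc //; move: nxy; rewrite ord_eqE /= /side.
have := ends_lt e; have := ltn_ord (snd_end e); have := ltn_ord x; have := ltn_ord y.
by case: (ltnP x y) => h'; lia.
Qed.

(* A boundary edge cuts off a single vertex, so it resolves no quartet. *)
Lemma side_boundary e : boundary e ->
  exists i, forall a b, a != b ->
   side e a (+) side e b = (a == i) (+) (b == i).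
Proof.
have h := ends_lt e; have hs := ltn_ord (snd_end e).
rewrite /boundary !ord_eqE !val_ordS /side.
case/orP=> /eqP; case: eqP => h1 h2; [exists (fst_end e) | exists (fst_end e) |
  exists (snd_end e) | exists (snd_end e)] => a b; rewrite !ord_eqE => nab;
  have := ltn_ord a; have := ltn_ord b; clear -h hs h1 h2 nab; lia.
Qed.

(** The 2-2 splits aa' | bb' and, in [splits_mid], ab' | a'b. An arc never cuts four vertices in
    cyclic order as ab | a'b'. *)
Definition splits_left e a a' b b' : bool :=
  [&& side e a == side e a', side e b == side e b' & side e a != side e b].

Definition splits_mid e a a' b b' : bool :=
  [&& side e a == side e b', side e a' == side e b & side e a != side e a'].

(** The ends of [e] lie in the cyclic intervals (a', b] and (b', a], those of [f] in (a, a'] and (b,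
    b'], so they alternate around the polygon. *)
Lemma splits_crossing e f a a' b b' : (a < a' < b)%N -> (b < b')%N ->
  splits_left e a a' b b' -> splits_mid f a a' b b' -> crossing e f.
Proof.
rewrite /splits_left /splits_mid /side /crossing.
have := ends_lt e; have := ends_lt f; lia.
Qed.

Lemma splits_left_boundary e a a' b b' : (a < a' < b)%N -> (b < b')%N ->
  splits_left e a a' b b' -> ~~ boundary e.
Proof.
move=> h1 h2 h3; apply/negP=> /side_boundary[i] h; move: h3.
have := h a a'; have := h b b'; have := h a b.
rewrite /splits_left !ord_eqE /=; lia.
Qed.

Lemma splits_mid_boundary e a a' b b' : (a < a' < b)%N -> (b < b')%N ->
  splits_mid e a a' b b' -> ~~ boundary e.
Proof.
move=> h1 h2 h3; apply/negP=> /side_boundary[i] h; move: h3.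
have := h a a'; have := h a b'; have := h a' b.
rewrite /splits_mid !ord_eqE /=; lia.
Qed.

End Combinatorics.

(** * Triangulations, quadrilaterals and crossing signs *)

Definition chord_cross (a b c d : nat) : bool :=
  let inside x := (a < x < b)%N || (b < x < a)%N in
  let outside x := (x < a)%N && (x < b)%N || (a < x)%N && (b < x)%N in
  inside c && outside d || inside d && outside c.

Lemma chord_crossC a b c d : chord_cross a b c d = chord_cross b a c d.
Proof. by rewrite /chord_cross; lia. Qed.

Lemma chord_cross_lt a b c d : (a < b)%N -> chord_cross a b c d =
  (a < c < b)%N && ((d < a) || (b < d))%N || (a < d < b)%N && ((c < a) || (b < c))%N.
Proof. by rewrite /chord_cross; lia. Qed.

Section Triangulations.
Variable n : nat.
Implicit Types (i j a b c p q x y : 'I_n) (d e f : edge n).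

Lemma crossingE e f : crossing e f =
  chord_cross (fst_end e) (snd_end e) (fst_end f) (snd_end f).
Proof.
by have := ends_lt e; have := ends_lt f; rewrite /crossing /chord_cross; lia.
Qed.

Lemma joinedP (T : {set edge n}) a b :
  reflect (exists2 e, e \in T & fst_end e = a /\ snd_end e = b \/
                                fst_end e = b /\ snd_end e = a)
          (joined T a b).
Proof.
apply: (iffP exists_inP) => -[e eT h]; exists e => //.
  by case/orP: h => /eqP; rewrite /fst_end /snd_end => ->; [left|right].
by case: e eT h => -[x y] xy _ /= [[<- <-]|[<- <-]]; rewrite !eqxx ?orbT.
Qed.

Lemma joinedC (T : {set edge n}) a b : joined T a b = joined T b a.
Proof. by apply/joinedP/joinedP => -[e eT h]; exists e; tauto. Qed.

Lemma joined_ends (T : {set edge n}) e : e \in T -> joined T (fst_end e) (snd_end e).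
Proof. by move=> eT; apply/joinedP; exists e => //; left. Qed.

Variable T : {set edge n}.
Hypothesis triT : triangulation T.

Lemma tri_noncrossing e f : e \in T -> f \in T -> ~~ crossing e f.
Proof.
case/maxsetP: triT => /forall_inP h _ eT fT.
by have /forall_inP := h _ eT; apply.
Qed.

Lemma joined_noncrossing a b c x :
  joined T a b -> joined T c x -> ~~ chord_cross a b c x.
Proof.
move=> /joinedP[e eT he] /joinedP[f fT hf].
have := tri_noncrossing eT fT; rewrite crossingE.
by case: he hf => -[-> ->] [] [-> ->]; rewrite /chord_cross; lia.
Qed.

(** Adding the chord keeps the set noncrossing, so by maximality it is already there. *)
Lemma joined_max a b : a != b ->
  (forall c x, joined T c x -> ~~ chord_cross a b c x) -> joined T a b.
Proof.
wlog ab : a b / (a < b)%N => [W nab h|nab h].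
  case: (ltngtP a b) => [|ba|/ord_inj E]; first by move/W; apply.
    rewrite joinedC; apply: W => //; first by rewrite eq_sym.
    by move=> c x /h; rewrite /chord_cross; lia.
  by rewrite E eqxx in nab.
pose e : edge n := exist _ (a, b) ab.
have [/forall_inP ncT maxT] := maxsetP triT.
suff : e |: T = T by move=> E; apply: (@joined_ends T e); rewrite -E setU11.
have ncr f : f \in T -> ~~ chord_cross a b (fst_end f) (snd_end f).
  by move=> fT; apply: h; apply: joined_ends.
apply: maxT; last exact: finset.subsetUr.
apply/forall_inP=> f fT'; apply/forall_inP=> g gT'.
case/setU1P: fT' => [->|fT]; case/setU1P: gT' => [->|gT].
- by rewrite crossingE /chord_cross; lia.
- by rewrite crossingE; apply: ncr.
- by rewrite /crossing orbC -/(crossing e f) crossingE; apply: ncr.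
- exact: tri_noncrossing.
Qed.

Lemma joined_ordS i : (1 < n)%N -> joined T i (ordS i).
Proof.
have hi := ltn_ord i.
move=> n1; apply: joined_max; first by rewrite ord_eqE val_ordS; case: ifP; lia.
move=> c x _; have := ltn_ord c; have := ltn_ord x.
by rewrite /chord_cross val_ordS; case: ifP; lia.
Qed.

(** Take for p the neighbour of i closest to j before j, and for q the first one after j. A chord of
    [T] crossing pj would have to cross ij or ip, or be an edge from i to a vertex strictly between
    p and j; hence pj is in [T] by maximality. The argument for jq is the same. *)
Lemma quad_exists d : d \in diagonals T -> exists p q, quad T d p q.
Proof.
rewrite inE => /andP[dT]; rewrite /boundary !ord_eqE !val_ordS => ndT.
set i := fst_end d in ndT *; set j := snd_end d in ndT *.
have ij : (i < j)%N by apply: ends_lt.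
have hj := ltn_ord j.
have jij : joined T i j by apply: joined_ends.
have n1 : (1 < n)%N by lia.
have [p [ip pj jip maxp]] : exists p, [/\ (i < p)%N, (p < j)%N, joined T i p &
    forall p', (i < p' < j)%N -> joined T i p' -> (p' <= p)%N].
  pose P p := [&& (i < p)%N, (p < j)%N & joined T i p].
  (* The boundary neighbour of i is a candidate, since [d] is not a boundary edge. *)
  have P0 : P (ordS i).
    by rewrite /P joined_ordS // val_ordS; move: ndT; case: eqP; case: ifP; lia.
  case: (arg_maxnP (fun p : 'I_n => val p) P0) => p /and3P[h1 h2 h3] h4.
  exists p; split=> // p' /andP[h5 h6] h7.
  by apply: h4; rewrite /P h5 h6 h7.
(* Unrolls the cyclic order just after j. *)
pose key q := (if (j < q)%N then q : nat else q + n)%N.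
have [q [hq jqi minq]] : exists q, [/\ (q < i)%N || (j < q)%N, joined T q i &
    forall q', (q' < i)%N || (j < q')%N -> joined T q' i -> (key q <= key q')%N].
  pose P q := ((q < i)%N || (j < q)%N) && joined T q i.
  have P0 : P (ord_pred i).
    have := joined_ordS (ord_pred i) n1; rewrite /P ord_predK => ->.
    rewrite val_ord_pred.
    by move: ndT; do 3?case: ifP; lia.
  case: (arg_minnP key P0) => q /andP[h1 h2] h3.
  by exists q; split=> // q' h4 h5; apply: h3; rewrite /P h4 h5.
exists p, q; rewrite /quad -/i -/j ip pj jip hq jqi /= andbT.
have hqn := ltn_ord q.
apply/andP; split; apply: joined_max; rewrite ?ord_eqE; try lia.
  move=> c c' jcc'; have := ltn_ord c; have := ltn_ord c'.
  have := joined_noncrossing jij jcc'; have := joined_noncrossing jip jcc'.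
  have k1 : c = i :> nat -> (i < c' < j)%N -> (c' <= p)%N.
    by move=> /ord_inj ci h; apply: maxp => //; rewrite -ci.
  have k2 : c' = i :> nat -> (i < c < j)%N -> (c <= p)%N.
    by move=> /ord_inj ci h; apply: maxp => //; rewrite -ci joinedC.
  rewrite !chord_cross_lt // => h1 h2 h3 h4.
  by apply/negP=> /orP[]/andP[h5 /orP[] h6]; clear maxp; lia.
move=> c c' jcc'; have := ltn_ord c; have := ltn_ord c'.
have := joined_noncrossing jij jcc'; have := joined_noncrossing jqi jcc'.
have k1 : c = i :> nat -> (c' < i)%N || (j < c')%N -> (key q <= key c')%N.
  by move=> /ord_inj ci h; apply: minq => //; rewrite -ci joinedC.
have k2 : c' = i :> nat -> (c < i)%N || (j < c)%N -> (key q <= key c)%N.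
  by move=> /ord_inj ci h; apply: minq => //; rewrite -ci.
move: k1 k2; rewrite (chord_cross_lt _ _ ij) /key => k1 k2.
case/orP: hq => hq.
  rewrite [in X in X -> _]chord_cross_lt // [in X in _ -> _ -> _ -> _ -> X]chord_crossC.
  rewrite [in X in _ -> _ -> _ -> _ -> X]chord_cross_lt; last by lia.
  move: k1 k2; rewrite (ltnNge j q) (_ : (q <= j)%N) /=; last by lia.
  move=> k1 k2 h1 h2 h3 h4.
  apply/negP=> /orP[]/andP[h5 /orP[] h6];
    move: k1 k2; case: (ltnP j c); case: (ltnP j c'); lia.
rewrite [in X in X -> _]chord_crossC;
rewrite [in X in X -> _]chord_cross_lt; last by lia.
rewrite [in X in _ -> _ -> _ -> _ -> X]chord_cross_lt //.
move: k1 k2; rewrite hq => k1 k2 h1 h2 h3 h4.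
apply/negP=> /orP[]/andP[h5 /orP[] h6];
    move: k1 k2; case: (ltnP j c); case: (ltnP j c'); lia.
Qed.

(** If p < p', the edges ip' and pj would cross; similarly for q. *)
Lemma quad_inj d p q p' q' : quad T d p q -> quad T d p' q' -> p = p' /\ q = q'.
Proof.
set i := fst_end d; set j := snd_end d.
move=> /and5P[hp jip jpj hq /andP[jjq jqi]].
move=> /and5P[hp' jip' jpj' hq' /andP[jjq' jqi']].
have := joined_noncrossing jip jpj'; have := joined_noncrossing jip' jpj.
have := joined_noncrossing jqi jjq'; have := joined_noncrossing jqi' jjq.
rewrite -/i -/j in hp hq hp' hq' *.
have ij : (i < j)%N by lia.
move=> h1 h2 h3 h4; split; apply: ord_inj.
  by clear h1 h2 hq hq'; move: h3 h4; rewrite !chord_cross_lt; lia.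
clear h3 h4 hp hp'; move: h1 h2; rewrite /chord_cross.
by case/orP: hq => hq; case/orP: hq' => hq'; lia.
Qed.

Lemma crossing_signE d p q e : quad T d p q ->
  crossing_sign T d e =
  if separated e (cyc_itv (ordS q) (fst_end d)) (cyc_itv (ordS p) (snd_end d))
  then 1
  else if separated e (cyc_itv (ordS (fst_end d)) p) (cyc_itv (ordS (snd_end d)) q)
  then -1 else 0.
Proof.
move=> hquad; rewrite /crossing_sign.
have E (F : 'I_n -> 'I_n -> bool) :
    [exists p, exists q, quad T d p q && F p q] = F p q.
  apply/existsP/idP => [[p' /existsP[q' /andP[h]]]|h].
    by case: (quad_inj hquad h) => <- <-.
  by exists p; apply/existsP; exists q; rewrite hquad.
by rewrite (E (fun p q => separated e (cyc_itv (ordS q) _) (cyc_itv (ordS p) _)))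
  (E (fun p q => separated e (cyc_itv _ p) (cyc_itv _ q))).
Qed.

(* Reading W_e on the sides of q(d): e meets the sides {i, p} and {j, q} when
   the sign is -1, the sides {p, j} and {q, i} when it is +1. *)
Lemma crossing_sign_shear d p q e : quad T d p q ->
  let i := fst_end d in let j := snd_end d in
  (side e i (+) side e p)%:R + (side e j (+) side e q)%:R
  - (side e p (+) side e j)%:R - (side e q (+) side e i)%:R
  = - (crossing_sign T d e *+ 2) :> int.
Proof.
move=> hquad i j; rewrite (crossing_signE _ hquad) -/i -/j.
case/and5P: hquad; rewrite -/i -/j => hp _ _ hq _.
have nip : i != p by rewrite ord_eqE; lia.
have npj : p != j by rewrite ord_eqE; lia.
have njq : j != q by rewrite ord_eqE; have := ltn_ord q; lia.
have nqi : q != i by rewrite ord_eqE; have := ltn_ord q; lia.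
rewrite !side_arc // /separated.
(* The four arcs partition the sides, so each end of [e] lies in exactly one of them and finitely
   many cases remain. *)
have arcs c : [:: c \in cyc_itv (ordS i) p; c \in cyc_itv (ordS p) j;
                  c \in cyc_itv (ordS j) q; c \in cyc_itv (ordS q) i]
   \in [:: [:: true; false; false; false]; [:: false; true; false; false];
           [:: false; false; true; false]; [:: false; false; false; true]].
  rewrite !mem_arc // !inE !eqseq_cons !eqxx.
  have := ltn_ord c; case: (ltnP i p); case: (ltnP p j); case: (ltnP j q);
  case: (ltnP q i); lia.
move: (arcs (fst_end e)) (arcs (snd_end e)).
by do 4!case: (fst_end e \in cyc_itv _ _); move=> // _;
  do 4!case: (snd_end e \in cyc_itv _ _).
Qed.

(** The ends of [e] number both its vertices and its sides. If they lie in (q, i] and (p, j], not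
    crossing qi and pj forces them to be i and j. If they lay in (i, p] and (j, q], [e] would cross
    [d]. *)
Lemma crossing_sign_diagonal d e : d \in diagonals T -> e \in T ->
  crossing_sign T d e = (d == e)%:R.
Proof.
move=> dT eT; have [p [q hquad]] := quad_exists dT.
rewrite (crossing_signE _ hquad).
case/and5P: hquad => hp jip jpj hq /andP[jjq jqi].
set i := fst_end d in hp jip jpj hq jjq jqi *.
set j := snd_end d in hp jip jpj hq jjq jqi *.
have -> : (d == e) = (i == fst_end e :> nat) && (j == snd_end e :> nat).
  apply/eqP/andP => [<-|[/eqP/ord_inj h1 /eqP/ord_inj h2]]; first by rewrite /i /j.
  exact: edge_eq.
have je := joined_ends eT.
have he := ends_lt e; have hqn := ltn_ord q; have hen := ltn_ord (snd_end e).
have jij : joined T i j by apply: joined_ends; move: dT; rewrite inE => /andP[].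
have := joined_noncrossing jij je; have := joined_noncrossing jpj je.
have := joined_noncrossing jqi je.
rewrite /separated; set k := fst_end e in he *; set l := snd_end e in he hen *.
move: hp => /andP[ip pj]; have ij := ltn_trans ip pj.
clear je jij jip jpj jjq jqi dT eT; clearbody i j k l.
rewrite !mem_arc ?ord_eqE; try by lia.
rewrite ip pj [chord_cross p j _ _]chord_cross_lt // [chord_cross i j _ _]chord_cross_lt //.
case/orP: hq => hq.
  have jq : (q < j)%N := ltn_trans hq ij.
  rewrite hq [(j < q)%N]ltnNge (ltnW jq) !chord_cross_lt //= => h1 h2 h3.
  case: ifP => h4.
    suff -> : (i == k :> nat) && (j == l :> nat) by [].
    by case/orP: h4 => /andP[h4 h5]; lia.
  rewrite ifF; last by clear h1 h2 h4; apply/negP=> /orP[]/andP[h4 h5]; lia.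
  suff -> : (i == k :> nat) && (j == l :> nat) = false by [].
  apply/negP=> /andP[/eqP E1 /eqP E2].
  by move: h4; rewrite -E1 -E2 hq pj !leqnn.
have iq : (i < q)%N := ltn_trans ij hq.
rewrite hq [(q < i)%N]ltnNge (ltnW iq) /= chord_crossC !chord_cross_lt //= => h1 h2 h3.
case: ifP => h4.
  suff -> : (i == k :> nat) && (j == l :> nat) by [].
  by case/orP: h4 => /andP[h4 h5]; lia.
rewrite ifF; last by clear h1 h2 h4; apply/negP=> /orP[]/andP[h4 h5]; lia.
suff -> : (i == k :> nat) && (j == l :> nat) = false by [].
apply/negP=> /andP[/eqP E1 /eqP E2].
by move: h4; rewrite -E1 -E2 pj !leqnn orbT.
Qed.

End Triangulations.

(** * Vectors as symmetric functions, and the basis of splits *)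

Section Dist.
Variables (R : realType) (n : nat).
Implicit Types (i j a b c p q x y : 'I_n) (d e f : edge n).
Implicit Types (u v : edge_space R n).

(** At most one summand is nonzero, since [entry] vanishes on unsorted pairs. *)
Definition dist a b v : R^o := entry v a b + entry v b a.

Lemma entry_linear a b : linear (fun v => entry v a b : R^o).
Proof.
move=> k u v; rewrite /entry; case: insubP => [e _ _|_] /=.
  by rewrite !ffunE.
by rewrite scaler0 addr0.
Qed.

Lemma dist_is_linear a b : linear (dist a b).
Proof. by move=> k u v; rewrite /dist !entry_linear scalerDr addrACA. Qed.

HB.instance Definition _ a b := GRing.isLinear.Build R (edge_space R n) R^o _
  (dist a b) (@dist_is_linear a b).

Lemma dist_sum (I : finType) (P : pred I) (k : I -> R) (w : I -> edge_space R n) a b :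
  dist a b (\sum_(i | P i) k i *: w i) = \sum_(i | P i) k i * dist a b (w i).
Proof. by rewrite linear_sum; apply: eq_bigr => i _; rewrite linearZ. Qed.

Lemma distC v a b : dist a b v = dist b a v.
Proof. by rewrite /dist addrC. Qed.

Lemma entry0 v a b : (b <= a)%N -> entry v a b = 0.
Proof. by move=> ba; rewrite /entry insubF //= ltnNge ba. Qed.

Lemma dist_entry v a b : (a < b)%N -> dist a b v = entry v a b.
Proof. by move=> ab; rewrite /dist [entry v b a]entry0 ?addr0 // ltnW. Qed.

Lemma distxx v a : dist a a v = 0.
Proof. by rewrite /dist !entry0 ?addr0. Qed.

Lemma dist_ends v e : dist (fst_end e) (snd_end e) v = v e.
Proof.
rewrite dist_entry ?ends_lt // /entry; case: e => -[a b] ab.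
by rewrite /= insubT.
Qed.

Lemma entryE v a b (ab : (a < b)%N) : entry v a b = v (exist _ (a, b) ab).
Proof. by rewrite -dist_ends /= dist_entry. Qed.

Lemma dist_cut v (s : 'I_n -> bool) :
  (forall e, v e = (s (fst_end e) (+) s (snd_end e))%:R) ->
  forall a b, dist a b v = (s a (+) s b)%:R.
Proof.
move=> h a b; wlog ab : a b / (a < b)%N => [W|].
  case: (ltngtP a b) => [/W|/W|/ord_inj ->] //; last by rewrite distxx addbb.
  by rewrite distC addbC.
by rewrite dist_entry // entryE h.
Qed.

Lemma dist_W e a b : dist a b (W R e) = (side e a (+) side e b)%:R.
Proof.
by apply: dist_cut => f; rewrite ffunE !mem_cyc_itv_ends.
Qed.

Lemma dist_pendant i a b :
  dist a b (Wvec R i (ordS i)) = ((a == i) (+) (b == i))%:R.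
Proof.
apply: (dist_cut (s := fun a => a == i)) => e; rewrite ffunE ordSK.
have E c : (c \in cyc_itv i i) = (c == i).
  by rewrite mem_cyc_itv leqnn ord_eqE; lia.
by rewrite !E.
Qed.

(** For the edge {0, n-1} the arc is the complement of the vertex n-1, which defines the same split
    as that vertex. *)
Lemma W_boundary e : boundary e -> W R e \in lineality R n.
Proof.
move=> /[dup] be /side_boundary[i hi].
have -> : W R e = Wvec R i (ordS i).
  apply/ffunP=> f; rewrite -!dist_ends dist_W dist_pendant hi //.
  by rewrite ord_eqE neq_ltn ends_lt.
by apply: memv_span; apply: fintype.image_f.
Qed.

Definition Wsum u : edge_space R n := \sum_e u e *: W R e.

(* The coefficient of the split {i, ..., j - 1} in v (the isolation index of
   Bandelt and Dress); the formula also covers adjacent i and j, since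
   [dist a a v = 0]. *)
Definition split_coef v e : R :=
  let i := fst_end e in let j := snd_end e in
  (dist (ord_pred i) (ord_pred j) v + dist i j v
   - dist (ord_pred i) j v - dist i (ord_pred j) v) / 2.

Lemma side_jump e i :
  (side e i)%:R - (side e (ord_pred i))%:R =
  (i == fst_end e)%:R - (i == snd_end e)%:R :> R.
Proof.
have he := ends_lt e; have hs := ltn_ord (snd_end e); have hi := ltn_ord i.
have h : ((i == fst_end e) + side e (ord_pred i) = (i == snd_end e) + side e i)%N.
  by rewrite !ord_eqE /side val_ord_pred; case: ifP => h; lia.
apply/eqP; rewrite subr_eq addrAC eq_sym subr_eq -!natrD h addnC //.
Qed.

(** With s the indicator of [side f], the distance is s(x) + s(y) - 2 s(x) s(y). The mixed
    difference kills the terms in one variable and leaves minus the product of the jumps of s at i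
    and at j. These are nonzero only at the ends of [f], with opposite signs there. *)
Lemma split_coef_W e f : split_coef (W R f) e = (e == f)%:R.
Proof.
rewrite /split_coef !dist_W.
have bE (x y : bool) : (x (+) y)%:R = x%:R + y%:R - x%:R * y%:R *+ 2 :> R.
  by case: x; case: y => /=; lra.
set i := fst_end e; set j := snd_end e.
transitivity (- (((side f i)%:R - (side f (ord_pred i))%:R) *
                 ((side f j)%:R - (side f (ord_pred j))%:R)) : R).
  by rewrite !bE; field.
rewrite !side_jump.
have -> : (e == f) = (i == fst_end f) && (j == snd_end f).
  by apply/eqP/andP => [<-|[/eqP ? /eqP ?]]; [split|apply: edge_eq].
have ij : (i < j)%N := ends_lt e; have hf := ends_lt f.
have h0 : (i == snd_end f) && (j == fst_end f) = false by rewrite !ord_eqE; lia.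
have h1 : (i == fst_end f) && (i == snd_end f) = false by rewrite !ord_eqE; lia.
have h2 : (j == fst_end f) && (j == snd_end f) = false by rewrite !ord_eqE; lia.
have h3 : (i == fst_end f) && (j == fst_end f) = false by rewrite !ord_eqE; lia.
have h4 : (i == snd_end f) && (j == snd_end f) = false by rewrite !ord_eqE; lia.
move: h0 h1 h2 h3 h4.
by do 4!case: (_ == _ :> 'I_n) => //=; lra.
Qed.

Lemma split_coef_sum u e : split_coef (Wsum u) e = u e.
Proof.
have -> : split_coef (Wsum u) e = \sum_f u f * split_coef (W R f) e.
  rewrite /split_coef !dist_sum -big_split /= -!sumrB mulr_suml.
  have scale (k x y z t : R) :
      (k * x + k * y - k * z - k * t) / 2 = k * ((x + y - z - t) / 2) by field.
  by apply: eq_bigr => f _; apply: scale.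
rewrite (bigD1 e) //= split_coef_W eqxx mulr1 big1 ?addr0 // => f fe.
by rewrite split_coef_W eq_sym (negPf fe) mulr0.
Qed.

Lemma Wsum_is_linear : linear Wsum.
Proof.
move=> k u v; rewrite /Wsum scaler_sumr -big_split /=; apply: eq_bigr => e _.
by rewrite !ffunE scalerDl scalerA.
Qed.

HB.instance Definition _ := GRing.isLinear.Build R (edge_space R n)
  (edge_space R n) _ Wsum Wsum_is_linear.

(* [split_coef] is a left inverse of [Wsum], which is therefore bijective. *)
Lemma split_decomposition v : v = \sum_e split_coef v e *: W R e.
Proof.
pose F := linfun Wsum.
have kerF : lker F == 0%VS.
  apply/lker0P => c c'; rewrite !lfunE /= => h.
  by apply/ffunP=> e; rewrite -!split_coef_sum h.
have := memvf v.
have <- : limg F = fullv.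
  by apply/eqP; rewrite eqEdim subvf limg_dim_eq ?leqnn // (eqP kerF) capv0.
case/memv_imgP=> c _; rewrite lfunE /= => ->.
by rewrite {1}/Wsum; apply: eq_bigr => e _; rewrite split_coef_sum.
Qed.

End Dist.

(** * The four-point condition and noncrossing splits *)

Section Pf1plusCones.
Variables (R : realType) (n : nat).
Implicit Types (i j a b : 'I_n) (e f : edge n) (v : edge_space R n).

Lemma max_twiceP (x y z : R) (m := Num.max x (Num.max y z)) :
  (2 <= count (pred1 m) [:: x; y; z])%N /\ x = m <->
  [/\ y <= x, z <= x & x = y \/ x = z].
Proof.
rewrite /m; split=> [[+ xm]|[yx zx xyz]].
  rewrite -xm /= eqxx => cnt; split.
  - by rewrite xm !le_max lexx orbT.
  - by rewrite xm !le_max lexx !orbT.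
  by move: cnt; case: eqP => [->|_]; [left|case: eqP => [->|//]; right].
have -> : Num.max x (Num.max y z) = x by apply/max_idPl; rewrite ge_max yx.
by rewrite /= eqxx; split=> //; case: xyz => <-; rewrite eqxx; case: (_ == x).
Qed.

Lemma Pf1plusP v : Pf1plus R n v <->
  forall a a' b b', (a < a' < b)%N -> (b < b')%N ->
    let x := dist a b v + dist a' b' v in
    let y := dist a a' v + dist b b' v in
    let z := dist a b' v + dist a' b v in
    [/\ y <= x, z <= x & x = y \/ x = z].
Proof.
have E a a' b b' : (a < a' < b)%N -> (b < b')%N ->
    (dist a b v = entry v a b) * (dist a' b' v = entry v a' b') *
    (dist a a' v = entry v a a') * (dist b b' v = entry v b b') *
    (dist a b' v = entry v a b') * (dist a' b v = entry v a' b).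
  by move=> /andP[h1 h2] h3; rewrite !dist_entry //; lia.
by split=> h a a' b b' h1 h2; have := h a a' b b' h1 h2;
  rewrite !(E a a' b b') //= => /max_twiceP.
Qed.

Variable v : edge_space R n.
Variables (P : pred (edge n)) (c : edge n -> R).
Hypothesis vE : v = \sum_(e | P e) c e *: W R e.
Variables a a' b b' : 'I_n.
Hypotheses (aa'b : (a < a' < b)%N) (bb' : (b < b')%N).

(** A split aa' | bb' contributes 2 to the difference; ab' | a'b and all 1-3 and trivial splits
    contribute 0. Only ab | a'b' would contribute -2, and no arc induces it. *)
Lemma quartet_left :
  dist a b v + dist a' b' v - (dist a a' v + dist b b' v) =
  \sum_(e | P e) c e * (splits_left e a a' b b')%:R *+ 2.
Proof.
rewrite vE !dist_sum -!big_split /= -sumrB; apply: eq_bigr => e _.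
rewrite !dist_W -!mulrDr -mulrBr -mulrnAr; congr (_ * _).
have : [|| side e a == side e a', side e b == side e b' | side e a != side e b].
  by rewrite /side; lia.
rewrite /splits_left.
by do 4![case: (side e _)] => //= _; lra.
Qed.

Lemma quartet_mid :
  dist a b v + dist a' b' v - (dist a b' v + dist a' b v) =
  \sum_(e | P e) c e * (splits_mid e a a' b b')%:R *+ 2.
Proof.
rewrite vE !dist_sum -!big_split /= -sumrB; apply: eq_bigr => e _.
rewrite !dist_W -!mulrDr -mulrBr -mulrnAr; congr (_ * _).
have : [|| side e a == side e a', side e b == side e b' | side e a != side e b].
  by rewrite /side; lia.
rewrite /splits_mid.
by do 4![case: (side e _)] => //= _; lra.
Qed.

End Pf1plusCones.

Section Pf1plusDecomposition.
Variables (R : realType) (n : nat).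
Implicit Types (i j a b : 'I_n) (e f : edge n) (v : edge_space R n).

(** By [splits_crossing], the two kinds of 2-2 split do not both occur at one quartet, so one of the
    two nonnegative differences is zero. *)
Lemma noncrossing_sum_Pf1plus (P : pred (edge n)) (c : edge n -> R) :
  (forall e, 0 <= c e) -> {in P &, forall e f, ~~ crossing e f} ->
  Pf1plus R n (\sum_(e | P e) c e *: W R e).
Proof.
move=> c_ge0 ncP; apply/Pf1plusP => a a' b b' h1 h2 x y z.
have := quartet_left erefl h1 h2; have := quartet_mid erefl h1 h2.
rewrite -/x -/y -/z => Ez Ey.
have ge0 e (s : bool) : 0 <= c e * s%:R *+ 2.
  by rewrite mulrn_wge0 // mulr_ge0.
split; first by rewrite -subr_ge0 Ey sumr_ge0 // => e _; apply: ge0.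
  by rewrite -subr_ge0 Ez sumr_ge0 // => e _; apply: ge0.
have [/existsP[e /andP[Pe le]]|nol] :=
    boolP [exists e, P e && splits_left e a a' b b'].
  right; apply/eqP; rewrite -subr_eq0 Ez big1 // => f Pf.
  case: (boolP (splits_mid f a a' b b')) => [mf|_]; last by rewrite mulr0 mul0rn.
  by have := splits_crossing h1 h2 le mf; rewrite (negPf (ncP _ _ Pe Pf)).
left; apply/eqP; rewrite -subr_eq0 Ey big1 // => e Pe.
case: (boolP (splits_left e a a' b b')) => [le|_]; last by rewrite mulr0 mul0rn.
by case/existsP: nol; exists e; rewrite Pe.
Qed.

(** This is one inequality of the four-point condition at i-1, i, j-1, j, which are distinct because
    [e] is a diagonal. *)
Lemma split_coef_ge0 v e :
  Pf1plus R n v -> ~~ boundary e -> 0 <= split_coef v e.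
Proof.
move=> /Pf1plusP Pv; rewrite /split_coef /boundary !ord_eqE !val_ordS.
have ij := ends_lt e; set i := fst_end e in ij *; set j := snd_end e in ij *.
have hj := ltn_ord j.
move=> nb; apply: divr_ge0 => //.
(* When i = 0 the predecessor wraps to n-1, so the sorted quartet becomes i, j-1, j, i-1 and the
   other inequality is needed. *)
have [i0|i0] := posnP i.
  have h1 : (i < ord_pred j < j)%N.
    by rewrite val_ord_pred; move: nb; do 3?case: ifP; lia.
  have h2 : (j < ord_pred i)%N.
    by rewrite val_ord_pred; move: nb; do 3?case: ifP; lia.
  have /= [h _ _] := Pv _ _ _ _ h1 h2.
  move: h; rewrite [dist j _ _]distC [dist (ord_pred j) _ _]distC; lra.
have h1 : (ord_pred i < i < ord_pred j)%N.
  by rewrite !val_ord_pred; move: nb; do 4?case: ifP; lia.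
have h2 : (ord_pred j < j)%N.
  by rewrite val_ord_pred; move: nb; do 3?case: ifP; lia.
have /= [_ h _] := Pv _ _ _ _ h1 h2.
by move: h; lra.
Qed.

(** If they crossed, take their four ends as the quartet: [e] splits it on the left and [f] in the
    middle. Then both differences are positive, and the maximum is attained only once. *)
Lemma split_coef_noncrossing v e f : Pf1plus R n v ->
  0 < split_coef v e -> 0 < split_coef v f -> ~~ crossing e f.
Proof.
move=> Pv.
wlog h : e f / (fst_end e < fst_end f < snd_end e)%N && (snd_end e < snd_end f)%N.
  move=> H ce cf; apply/negP => /[dup] cr /orP[h|h].
    by have := H _ _ h ce cf; rewrite cr.
  by have := H _ _ h cf ce; rewrite /crossing orbC -/(crossing e f) cr.
move: h => /andP[h1 h2] ce cf.
have /Pf1plusP/(_ _ _ _ _ h1 h2)[h3 h4 h5] := Pv.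
have := quartet_left (split_decomposition v) h1 h2.
have := quartet_mid (split_decomposition v) h1 h2.
(* Boundary coefficients may be negative, but boundary edges induce no 2-2 split. *)
have pos (F : pred (edge n)) g : (forall e, F e -> ~~ boundary e) -> F g ->
    0 < split_coef v g -> 0 < \sum_e split_coef v e * (F e)%:R *+ 2.
  move=> Fb Fg cg; rewrite (bigD1 g) //= ltr_wpDr //.
    apply: sumr_ge0 => e' _; case: (boolP (F e')) => [Fe'|_].
      by rewrite mulr1 mulrn_wge0 // split_coef_ge0 // Fb.
    by rewrite mulr0 mul0rn.
  by rewrite Fg mulr1 mulrn_wgt0.
have he := ends_lt e; have hf := ends_lt f.
have := @pos (fun g => splits_left g _ _ _ _) e
  (fun g => @splits_left_boundary _ g _ _ _ _ h1 h2) _ ce.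
have := @pos (fun g => splits_mid g _ _ _ _) f
  (fun g => @splits_mid_boundary _ g _ _ _ _ h1 h2) _ cf.
have -> : splits_left e (fst_end e) (fst_end f) (snd_end e) (snd_end f).
  by rewrite /splits_left /side; lia.
have -> : splits_mid f (fst_end e) (fst_end f) (snd_end e) (snd_end f).
  by rewrite /splits_mid /side; lia.
move=> /(_ isT) + /(_ isT) => p1 p2 E1 E2.
rewrite -E1 in p1; rewrite -E2 in p2.
by case: h5 => h5; rewrite h5 subrr ltxx in p1 p2.
Qed.

(** The diagonals with positive coefficient are noncrossing, so they extend to a triangulation; the
    boundary part of the split decomposition is absorbed by the lineality space. *)
Lemma Pf1plus_cover v : Pf1plus R n v ->
  exists2 T, triangulation T &
  exists2 c : edge n -> R, (forall e, 0 <= c e) &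
  exists2 u, u \in lineality R n & v = u + \sum_(e in diagonals T) c e *: W R e.
Proof.
move=> Pv; pose S := [set e | ~~ boundary e && (0 < split_coef v e)].
have ncS : noncrossing S.
  apply/forall_inP => e; rewrite inE => /andP[_ ce].
  apply/forall_inP => f; rewrite inE => /andP[_ cf].
  exact: (split_coef_noncrossing Pv).
have [T triT ST] := maxset_exists ncS.
exists T => //.
exists (fun e => if boundary e then 0 else split_coef v e).
  by move=> e; case: (boolP (boundary e)) => // be; apply: split_coef_ge0.
exists (\sum_(e | boundary e) split_coef v e *: W R e).
  by apply: memv_suml => e be; rewrite memvZ ?W_boundary.
rewrite {1}[v]split_decomposition (bigID (fun e => boundary e)) /=; congr (_ + _).
rewrite (bigID (fun e => e \in T)) /= [X in _ + X]big1 ?addr0; last first.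
  move=> e /andP[be eT]; suff -> : split_coef v e = 0 by rewrite scale0r.
  apply/eqP; rewrite eq_le split_coef_ge0 // andbT leNgt; apply/negP => ce.
  by case/negP: eT; apply: (fintype.subsetP ST); rewrite inE be.
apply: eq_big => [e|e /andP[be _]]; first by rewrite inE andbC.
by rewrite (negPf be).
Qed.

End Pf1plusDecomposition.

(** * Transport of cones and fans along linear maps *)

Section Cones.
Local Open Scope classical_set_scope.
Variables (R : realType) (V U : lmodType R).

Lemma face_refl (C : set V) : face C C.
Proof.
exists (\0 : {scalar V}); split=> //.
by apply/seteqP; split=> [x Cx|x []].
Qed.

Lemma image_cone (I : finType) (A : {set I}) (g : I -> V) (f : {linear V -> U}) :
  f @` cone A g = cone A (f \o g).
Proof.
have E c : f (\sum_(i in A) c i *: g i) = \sum_(i in A) c i *: (f \o g) i.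
  by rewrite linear_sum; apply: eq_bigr => i _; rewrite linearZ.
apply/seteqP; split=> [_ [_ [c [c0 ->]] <-]|_ [c [c0 ->]]].
  by exists c.
by exists (\sum_(i in A) c i *: g i); [exists c|].
Qed.

End Cones.

Section FanImage.
Local Open Scope classical_set_scope.
Variable R : realType.

(** The supporting functional is transported by composing it with [g]. *)
Lemma face_image (V U : lmodType R) (f : {linear V -> U}) (g : {linear U -> V}) :
  cancel f g -> forall F C : set V, face F C -> face (f @` F) (f @` C).
Proof.
move=> fK F C [l [lC ->]]; exists (l \o g : {scalar U}); split.
  by move=> _ [x Cx <-] /=; rewrite fK; apply: lC.
apply/seteqP; split=> [_ [x [Cx lx] <-]|_ [[x Cx <-]]] /=.
  by split; [exists x|rewrite fK].
by rewrite fK => lx; exists x.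
Qed.

Lemma fan_of_image (V U : lmodType R) (f : {linear V -> U}) (g : {linear U -> V})
    (M : set (set V)) : cancel f g -> cancel g f ->
  [set f @` F | F in fan_of M] = fan_of [set f @` C | C in M].
Proof.
move=> fK gK; have gfK (A : set V) : g @` (f @` A) = A.
  apply/seteqP; split=> [_ [_ [x Ax <-] <-]|x Ax]; first by rewrite fK.
  by exists (f x); [exists x|rewrite fK].
have fgK (A : set U) : f @` (g @` A) = A.
  apply/seteqP; split=> [_ [_ [x Ax <-] <-]|x Ax]; first by rewrite gK.
  by exists (g x); [exists x|rewrite gK].
apply/seteqP; split=> [_ [F [C MC FC] <-]|F [_ [C MC <-] FC]].
  by exists (f @` C); [exists C|apply: face_image FC].
exists (g @` F) => //; exists C => //.
by rewrite -(gfK C); apply: face_image FC.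
Qed.

End FanImage.

(** * Shear coordinates and the basis of rays *)

Section Shear.
Variables (R : realType) (n : nat) (T : {set edge n}).
Hypothesis triT : triangulation T.
Implicit Types (e : edge n) (v : edge_space R n).

Local Notation diag := {d : edge n | d \in diagonals T}.

Variables P Q : diag -> 'I_n.
Hypothesis quadPQ : forall d : diag, quad T (val d) (P d) (Q d).

Definition shear v : coord_space R (diagonals T) :=
  [ffun d : diag => let i := fst_end (val d) in let j := snd_end (val d) in
    dist i (P d) v + dist j (Q d) v - dist (P d) j v - dist (Q d) i v].

Lemma shear_is_linear : linear shear.
Proof.
move=> k u v; apply/ffunP=> d; rewrite !ffunE /= !dist_is_linear.
have E (x y z t x' y' z' t' : R) : k * x + x' + (k * y + y') - (k * z + z') -
    (k * t + t') = k * (x + y - z - t) + (x' + y' - z' - t') by ring.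
exact: E.
Qed.

HB.instance Definition _ := GRing.isLinear.Build R (edge_space R n)
  (coord_space R (diagonals T)) _ shear shear_is_linear.

Lemma shear_W e : shear (W R e) = - 2 *: gvector R T e.
Proof.
apply/ffunP=> d; rewrite !ffunE /= !dist_W.
have /(congr1 (fun z : int => z%:~R : R)) := crossing_sign_shear triT e (quadPQ d).
by rewrite !raddfB !raddfD /= !mulrz_nat => ->; rewrite mulrNz scalerDl !scaleN1r.
Qed.

Lemma gvector_diagonal (d : diag) :
  gvector R T (val d) = [ffun d' : diag => (d' == d)%:R].
Proof.
apply/ffunP=> d'; rewrite !ffunE crossing_sign_diagonal //; last 2 first.
- exact: (valP d').
- by have := valP d; rewrite inE => /andP[].
by rewrite mulrz_nat (inj_eq val_inj).
Qed.

(** Each of i, p, j, q occurs in one positive and one negative term, so the vectors of single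
    vertices cancel. *)
Lemma shear_lineality u : u \in lineality R n -> shear u = 0.
Proof.
suff : (lineality R n <= lker (linfun shear))%VS.
  by move=> h /(subvP h); rewrite memv_ker lfunE /= => /eqP.
apply/span_subvP => _ /fintype.imageP[i _ ->]; rewrite memv_ker lfunE /=.
apply/eqP/ffunP=> d; rewrite !ffunE /= !dist_pendant.
case/and5P: (quadPQ d) => /andP[h1 h2] _ _ h3 _.
have := ltn_ord (Q d) => h4.
have := ends_lt (val d); set a := fst_end _; set b := snd_end _ => ab.
have E (x y : 'I_n) : x != y ->
    ((x == i) (+) (y == i))%:R = (x == i)%:R + (y == i)%:R :> R.
  by move=> xy; case: eqP => [xi|_]; case: eqP => [yi|_] //=;
    rewrite ?addr0 ?add0r //; rewrite xi yi eqxx in xy.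
rewrite !E ?ord_eqE; try by rewrite -/a -/b in h1 h2 h3; lia.
by lra.
Qed.

Lemma shear_proj v : proj R T v = 0 -> shear v = 0.
Proof.
move=> v0; have vT e : e \in T -> v e = 0.
  move=> eT; have /ffunP/(_ (exist _ e eT)) := v0.
  by rewrite lfunE !ffunE.
have vJ a b : joined T a b -> dist a b v = 0.
  move=> /joinedP[e eT [[<- <-]|[<- <-]]]; last rewrite distC.
    by rewrite dist_ends vT.
  by rewrite dist_ends vT.
apply/ffunP=> d; rewrite !ffunE /=.
case/and5P: (quadPQ d) => _ h1 h2 _ /andP[h3 h4].
by rewrite !vJ // !subr0 addr0.
Qed.

Lemma proj_surj : limg (proj R T) = fullv.
Proof.
apply/eqP; rewrite eqEsubv subvf /=; apply/subvP => x _.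
apply/memv_imgP; exists [ffun e => oapp x 0 (insub e)]; first exact: memvf.
rewrite lfunE; apply/ffunP => e; rewrite !ffunE; case: insubP => [f _ E|].
  by congr (x _); apply: val_inj.
by rewrite (valP e).
Qed.

Variable phi : 'Hom(coord_space R T, coord_space R (diagonals T)).
Hypothesis phi_surj : limg phi = fullv.
Hypothesis phi_ker : lker phi = (proj R T @: lineality R n)%VS.

(* Both maps are onto the same space, so one inclusion of kernels suffices. *)
Lemma lker_shear : lker (phi \o proj R T)%VF = lker (linfun shear).
Proof.
have limg1 : limg (phi \o proj R T)%VF = fullv.
  by rewrite limg_comp proj_surj.
have limg2 : limg (linfun shear) = fullv.
  apply/eqP; rewrite eqEsubv subvf /=; apply/subvP => y _; apply/memv_imgP.
  (* The scalar inverts the factor -2 of [shear_W]; the g-vectors of the diagonals of [T] are the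
     unit vectors. *)
  exists (- 2^-1 *: \sum_(d : diag) y d *: W R (val d)); first exact: memvf.
  rewrite lfunE linearZ linear_sum /=.
  apply/ffunP => d; rewrite ffunE sum_ffunE (bigD1 d) //= big1.
    rewrite addr0 linearZ /= shear_W gvector_diagonal !ffunE eqxx.
    by rewrite /GRing.scale /=; field.
  move=> d' d'd; rewrite linearZ /= shear_W gvector_diagonal !ffunE eq_sym.
  by rewrite (negPf d'd) /= !scaler0.
apply/eqP; rewrite eqEdim; apply/andP; split.
  apply/subvP => v; rewrite memv_ker comp_lfunE -memv_ker phi_ker.
  (* The vector [v] has the same projection as some [u] in the lineality space, and the shear map
     kills both [u] and [v - u]. *)
  case/memv_imgP => u uL vu; rewrite memv_ker lfunE /=.
  have <- : u + (v - u) = v by rewrite addrC subrK.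
  rewrite linearD /= shear_lineality // add0r shear_proj //.
  by rewrite linearB /= vu subrr.
have := limg_ker_dim (phi \o proj R T)%VF fullv.
have := limg_ker_dim (linfun shear) fullv.
by rewrite limg1 limg2 !capfv; lia.
Qed.

Lemma phi_shear v : shear v = 0 -> phi (proj R T v) = 0.
Proof.
move=> h; have : v \in lker (linfun shear) by rewrite memv_ker lfunE /= h.
by rewrite -lker_shear memv_ker comp_lfunE => /eqP.
Qed.

(** The candidate inverse of [Wbar_coords], usable before the rays are known to form a basis. *)
Definition Wbar_comb (y : coord_space R (diagonals T)) :
    coord_space R (diagonals T) :=
  \sum_(d : diag) y d *: Wbar phi (val d).

Lemma Wbar_comb_is_linear : linear Wbar_comb.
Proof.
move=> k u v; rewrite /Wbar_comb scaler_sumr -big_split; apply: eq_bigr => d _.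
by rewrite !ffunE scalerDl scalerA.
Qed.

HB.instance Definition _ := GRing.isLinear.Build R (coord_space R (diagonals T))
  (coord_space R (diagonals T)) _ Wbar_comb Wbar_comb_is_linear.

(** The image under [phi] depends only on the shear, and [w] is the combination of the [W] of
    diagonals of [T] with the same shear as [v]. *)
Lemma phi_Wbar_comb v : phi (proj R T v) = Wbar_comb (- 2^-1 *: shear v).
Proof.
pose w := \sum_(d : diag) (- 2^-1 *: shear v) d *: W R (val d).
have -> : Wbar_comb (- 2^-1 *: shear v) = phi (proj R T w).
  by rewrite /w !linear_sum; apply: eq_bigr => d _; rewrite !linearZ.
apply/eqP; rewrite -subr_eq0 -!linearB /= phi_shear // linearB /=.
apply/eqP; rewrite subr_eq0; apply/eqP/ffunP => d.
rewrite /w linear_sum sum_ffunE (bigD1 d) //= big1 => [|d' d'd].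
  rewrite addr0 linearZ /= shear_W gvector_diagonal !ffunE eqxx.
  by rewrite /GRing.scale /=; field.
rewrite linearZ /= shear_W gvector_diagonal !ffunE eq_sym.
by rewrite (negPf d'd) /= !scaler0.
Qed.

Lemma Wbar_gvector e : Wbar phi e = Wbar_comb (gvector R T e).
Proof.
rewrite /Wbar phi_Wbar_comb shear_W scalerA; congr Wbar_comb.
by rewrite mulrNN mulVf ?scale1r // pnatr_eq0.
Qed.

Lemma Wbar_comb_basis y :
  Wbar_comb y = \sum_(k < #|{: diag}|) y (enum_val k) *: (Wbar_basis phi)`_k.
Proof.
rewrite /Wbar_comb (reindex _ (onW_bij _ (@enum_val_bij _))).
by apply: eq_bigr => k _; rewrite -tnth_nth tnth_mktuple.
Qed.

(** The rays span by surjectivity, and there are as many as the dimension; independence follows. *)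
Lemma Wbar_basis_of_fullv : basis_of fullv (Wbar_basis phi).
Proof.
rewrite basisEdim size_tuple; apply/andP; split; last first.
  by rewrite dimvf /dim /= [dim _](_ : _ = 1%N) // muln1.
apply/subvP => x _.
have := memvf x; rewrite -phi_surj => /memv_imgP[x' _ ->].
have := memvf x'; rewrite -proj_surj => /memv_imgP[v _ ->].
rewrite phi_Wbar_comb Wbar_comb_basis memv_suml // => k _.
by rewrite memvZ // memv_span // mem_nth // size_tuple.
Qed.

Lemma Wbar_coords_is_linear : linear (@Wbar_coords R n T phi).
Proof. by move=> k u v; apply/ffunP=> d; rewrite !ffunE linearP. Qed.

HB.instance Definition _ := GRing.isLinear.Build R (coord_space R (diagonals T))
  (coord_space R (diagonals T)) _ (@Wbar_coords R n T phi) Wbar_coords_is_linear.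

Lemma Wbar_combK : cancel Wbar_comb (@Wbar_coords R n T phi).
Proof.
move=> y; apply/ffunP => d; rewrite ffunE Wbar_comb_basis.
by rewrite coord_sum_free ?enum_rankK // (basis_free Wbar_basis_of_fullv).
Qed.

Lemma Wbar_coordsK : cancel (@Wbar_coords R n T phi) Wbar_comb.
Proof.
move=> x; rewrite Wbar_comb_basis [RHS](coord_basis Wbar_basis_of_fullv (memvf x)).
by apply: eq_bigr => k _; rewrite ffunE enum_valK.
Qed.

Lemma Wbar_coords_Wbar e : Wbar_coords phi (Wbar phi e) = gvector R T e.
Proof. by rewrite Wbar_gvector Wbar_combK. Qed.

Local Open Scope classical_set_scope.

Lemma Wbar_coords_Sigma :
  [set Wbar_coords phi @` C | C in Sigma phi] = gvector_fan R T.
Proof.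
rewrite (fan_of_image _ Wbar_coordsK Wbar_combK); congr fan_of.
have E T' : Wbar_coords phi @` cone (diagonals T') (Wbar phi) =
            cone (diagonals T') (gvector R T).
  rewrite image_cone; congr cone.
  by apply/funext => e; rewrite /= Wbar_coords_Wbar.
apply/seteqP; split=> [_ [_ [T' tT' ->] <-]|_ [T' tT' ->]]; first by exists T'.
by exists (cone (diagonals T') (Wbar phi)); [exists T'|].
Qed.

(** Each face lies in its cone and each cone is a face of itself, so only maximal cones matter. For
    them, [Pf1plus_cover] gives one inclusion, the lineality part being killed by [phi], and
    [noncrossing_sum_Pf1plus] the other. *)
Lemma bigcup_Sigma :
  \bigcup_(C in Sigma phi) C = (phi \o proj R T) @` Pf1plus R n.
Proof.
have WbarE c T' : \sum_(e in diagonals T') c e *: Wbar phi e =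
    phi (proj R T (\sum_(e in diagonals T') c e *: W R e)).
  by rewrite !linear_sum; apply: eq_bigr => e _; rewrite !linearZ.
apply/seteqP; split=> [x [F [_ [T' tT' ->] [l [_ ->]]] [[c [c0 ->]] _]]|].
  exists (\sum_(e in diagonals T') c e *: W R e); last by rewrite /= WbarE.
  apply: noncrossing_sum_Pf1plus => // e f.
  rewrite !inE => /andP[eT _] /andP[fT _]; exact: (tri_noncrossing tT').
move=> _ [v Pv <-]; have [T' tT' [c c0 [u uL ->]]] := Pf1plus_cover Pv.
exists (cone (diagonals T') (Wbar phi)).
  by exists (cone (diagonals T') (Wbar phi)); [exists T'|apply: face_refl].
exists c; split=> //; rewrite WbarE /= !linearD /=.
suff -> : phi (proj R T u) = 0 by rewrite add0r.
by apply/eqP; rewrite -memv_ker phi_ker memv_img.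
Qed.

End Shear.

Local Open Scope classical_set_scope.
Local Open Scope ring_scope.

Theorem theorem4p6 (R : realType) (n : nat) (n_ge4 : (4 <= n)%N)
    (T : {set edge n}) (triT : triangulation T)
    (phi : 'Hom(coord_space R T, coord_space R (diagonals T)))
    (phi_surj : limg phi = fullv)
    (phi_ker : lker phi = (proj R T @: lineality R n)%VS) :
  [/\ \bigcup_(C in Sigma phi) C = (phi \o proj R T) @` Pf1plus R n,
      basis_of fullv (Wbar_basis phi) &
      [set Wbar_coords phi @` C | C in Sigma phi] = gvector_fan R T].
Proof.
have quads (d : {d : edge n | d \in diagonals T}) :
    exists pq : 'I_n * 'I_n, quad T (val d) pq.1 pq.2.
  by have [p [q h]] := quad_exists triT (valP d); exists (p, q).
(* The shear map needs the two apexes as functions of the diagonal. *)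
have [pq quadPQ] := choice quads.
split; first exact: bigcup_Sigma.
- exact: (Wbar_basis_of_fullv triT quadPQ).
- exact: (Wbar_coords_Sigma triT quadPQ).
Qed.
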